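(* Let $T_c>0$ and $x_0\in\mathbb{R}$, and consider the undisturbed scalar system $\dot x=u$ (i.e. $d(t)=0$). Then the trajectory $x(t)$ resulting from the controller $u=\kappa(t)v(x)$, $t\in[0,T_c)$, with $v(x)=-x$ and $\kappa(t)=\dfrac{1}{T_c-t}$, minimizes, under the constraints $x(0)=x_0$ and $x(T_c)=0$, the energy function $$E_{T_c}=\int_0^{T_c}u(\xi)^2\,\mathrm{d}\xi .$$
   Context: Here $\kappa(t)=\frac{\eta}{\alpha(T_c-\eta t)}$ with $\alpha=1$ and $\eta=1$. The minimization is among all controllers $u$ driving the state of $\dot x=u$ from $x(0)=x_0$ to $x(T_c)=0$; the energy of a trajectory is $\int_0^{T_c}\dot x(\xi)^2\,\mathrm{d}\xi$. *)

(* Defs.v *)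
From HB Require Import structures.
From mathcomp Require Import all_boot all_order all_algebra.
From mathcomp Require Import all_classical all_reals all_analysis.

Set Implicit Arguments.
Unset Strict Implicit.
Unset Printing Implicit Defensive.

Import Order.TTheory GRing.Theory Num.Theory.
Import numFieldNormedType.Exports.
Local Open Scope classical_set_scope.
Local Open Scope ring_scope.

(* [x] is a solution on [I] (an interval with left endpoint 0) of the scalar
   system x' = u in the sense of Carathéodory: [u] is Lebesgue integrable on
   each [0, t] with t in I, and [x] is a primitive of [u], i.e. x is locally
   absolutely continuous on I with x' = u almost everywhere. *)
Definition solution (R : realType) (I : set R) (u x : R -> R) : Prop :=
  forall t, I t ->
    (@lebesgue_measure R).-integrable `[0, t] (EFin \o u) /\
    x t = x 0 + \int[@lebesgue_measure R]_(s in `[0, t]) u s.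

Definition kappa (R : realType) (Tc t : R) : R := 1 / (Tc - t).

Definition v (R : realType) (x : R) : R := - x.

(* The control signal generated along [x] by the feedback u = kappa(t) v(x).
   Only its values on [0, Tc) are meaningful: at t = Tc the gain is the junk
   value 1 / 0 = 0, which is harmless since only integrals of it are used. *)
Definition feedback (R : realType) (Tc : R) (x : R -> R) : R -> R :=
  fun t => kappa Tc t * v (x t).

(* The solution is required on the half-open interval, where the gain is
   defined: reaching 0 at time Tc is not part of the definition. *)
Definition closed_loop_trajectory (R : realType) (Tc x0 : R) (x : R -> R)
    : Prop :=
  solution `[0, Tc[ (feedback Tc x) x /\ x 0 = x0.

Definition steers (R : realType) (Tc x0 : R) (u x : R -> R) : Prop :=
  [/\ solution `[0, Tc] u x, x 0 = x0 & x Tc = 0].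

(* Extended-real valued, so that integrable controls which are not square
   integrable are allowed as competitors, with energy +oo. *)
Definition energy (R : realType) (Tc : R) (u : R -> R) : \bar R :=
  (\int[@lebesgue_measure R]_(s in `[0%R, Tc]) ((u s) ^+ 2)%:E)%E.

Definition minimizes_energy (R : realType) (Tc x0 : R) (u x : R -> R) : Prop :=
  steers Tc x0 u x /\
  forall w y : R -> R, steers Tc x0 w y -> (energy Tc u <= energy Tc w)%E.

(* Main.v *)
Require Import Defs.
From HB Require Import structures.
From mathcomp Require Import all_boot all_order all_algebra.
From mathcomp Require Import all_classical all_reals all_analysis.
From mathcomp Require Import measurable_realfun ring lra.

Set Implicit Arguments.
Unset Strict Implicit.
Unset Printing Implicit Defensive.

Import Order.TTheory GRing.Theory Num.Theory.
Import numFieldNormedType.Exports.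
Local Open Scope classical_set_scope.
Local Open Scope ring_scope.

(** The closed loop y' = - y / (Tc - t) makes y / (Tc - t) constant, since its
    derivative is (y' (Tc - t) + y) / (Tc - t)^2 = 0. So its only trajectory
    is the straight line from x0 at time 0 to 0 at time Tc, and along it the
    control is the constant c = - x0 / Tc.  A merely integrable feedback
    signal suffices for this: a trajectory, being a primitive, is continuous,
    hence so is the feedback, hence the trajectory is differentiable
    ([closed_loop_quotient_cst]).

    Optimality is convexity of the square: w^2 >= 2 c w - c^2 pointwise, so
    the energy of w is at least 2 c (int w) - c^2 Tc ([energy_ge]).  Steering
    x0 to 0 fixes int w = - x0 = c Tc, and the bound becomes c^2 Tc, the
    energy of the constant control c. *)

(** The right endpoint is excluded because the feedback signal equals its
    constant value only before the terminal time, where the gain degenerates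
    to 1 / 0 = 0. *)
Lemma integrable_eq_cst_co (R : realType) (b c : R) (f : R -> R) : 0 <= b ->
  {in `[0, b[, f =1 cst c} ->
  (@lebesgue_measure R).-integrable `[0, b] (EFin \o f).
Proof.
move=> b0 fc.
have eq_c : {in `[0, b[%classic, cst c%:E =1 (EFin \o f)}.
  by move=> s; rewrite inE/= => sb; rewrite fc.
have mf : @measurable_fun _ _ R (\bar R) `[0, b] (EFin \o f).
  apply/emeasurable_fun_itv_bndo_bndcP.
  by apply: eq_measurable_fun; [exact: eq_c|exact: measurable_cst].
apply/integrableP; split=> //.
rewrite -integral_itv_bndo_bndc; last first.
  by apply: measurableT_comp => //; apply/emeasurable_fun_itv_bndo_bndcP.
under eq_integral => s sb do rewrite -eq_c//.
rewrite integral_cst//= lebesgue_measure_itv/= lte_fin.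
by case: ifP => _; rewrite ?mule0 ?ltry// -EFinD -EFinM ltry.
Qed.

Lemma integral_eq_cst_co (R : realType) (b c : R) (f : R -> R) : 0 <= b ->
  {in `[0, b[, f =1 cst c} ->
  (\int[@lebesgue_measure R]_(s in `[0%R, b]) (f s)%:E = (c * b)%:E)%E.
Proof.
move=> b0 fc.
have mf := measurable_int _ (integrable_eq_cst_co b0 fc).
rewrite -integral_itv_bndo_bndc; last exact/emeasurable_fun_itv_bndo_bndcP.
rewrite (eq_integral (cst c%:E)); last by move=> s /[!inE]/= sb; rewrite fc.
rewrite integral_cst//= lebesgue_measure_itv/= lte_fin.
case: ifPn => [_|]; first by rewrite oppr0 adde0 EFinM.
rewrite -leNgt => b_le0; have -> : b = 0 by apply/le_anti; rewrite b_le0 b0.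
by rewrite mule0 mulr0.
Qed.

(** Integrated form of w^2 >= 2 c w - c^2; the right-hand side depends on w only
    through its integral, which the boundary conditions determine. *)
Lemma energy_ge (R : realType) (T c : R) (w : R -> R) : 0 <= T ->
  (@lebesgue_measure R).-integrable `[0, T] (EFin \o w) ->
  ((2 * c * \int[@lebesgue_measure R]_(s in `[0%R, T]) w s - c ^+ 2 * T)%:E
    <= energy T w)%E.
Proof.
move=> T0 iw.
have mT : measurable (`[0, T] : set (measurableTypeR R)) by [].
have ic k : (@lebesgue_measure R).-integrable `[0, T] (EFin \o cst k).
  exact: (integrable_eq_cst_co (c := k)).
have i2cw : (@lebesgue_measure R).-integrable `[0, T]
    (EFin \o (fun s => 2 * c * w s)).
  exact: (integrableZl mT (2 * c) iw).
have mw2 : @measurable_fun _ _ R (\bar R) `[0, T]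
    (EFin \o (fun s => w s ^+ 2)).
  apply/measurable_EFinP; apply: measurable_funX; apply/measurable_EFinP.
  exact: measurable_int iw.
(* A control of infinite energy satisfies the bound trivially; otherwise w^2 is
   integrable and the pointwise inequality can be integrated. *)
have := leey (energy T w); rewrite le_eqVlt => /predU1P[->|e_fin].
  by rewrite leey.
have iw2 : (@lebesgue_measure R).-integrable `[0, T]
    (EFin \o (fun s => w s ^+ 2)).
  apply/integrableP; split=> //.
  by under eq_integral => s _ do rewrite /= ger0_norm ?sqr_ge0//.
rewrite -RintegralZl//.
have <- : \int[@lebesgue_measure R]_(s in `[0%R, T]) (c ^+ 2) = c ^+ 2 * T.
  by rewrite /Rintegral (integral_eq_cst_co (c := c ^+ 2)).
rewrite -RintegralB//; last exact: ic.
rewrite /energy -[leRHS]fineK; last exact: integral_fune_fin_num iw2.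
rewrite lee_fin; apply: le_Rintegral => //.
  exact: (integrableB mT i2cw (ic _)).
by move=> s _; have := sqr_ge0 (w s - c); lra.
Qed.

Lemma solution_within_continuous (R : realType) (b : R) (u x : R -> R) :
  0 <= b -> solution `[0, b] u x -> {within `[0, b], continuous x}.
Proof.
move=> b0 sol; have [|ub _] := sol b; first by rewrite /= in_itv/= b0 lexx.
pose F s := x 0 + parameterized_integral lebesgue_measure 0 s u.
apply: (@subspace_eq_continuous _ _ _ F).
  by move=> s /[!inE] sb; exact: esym (sol s sb).2.
apply: within_continuousD; first exact: cst_continuous.
exact: parameterized_integral_continuous.
Qed.

(** The equation says exactly that y / (Tc - t) has zero derivative on ]0, b[,
    and this quotient is continuous on [0, b] as b < Tc keeps the denominator
    away from 0; the mean value theorem concludes. *)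
Lemma closed_loop_quotient_cst (R : realType) (Tc x0 b : R) (y : R -> R) :
  closed_loop_trajectory Tc x0 y -> 0 <= b < Tc -> y b / (Tc - b) = y 0 / Tc.
Proof.
move=> [sol _] /andP[b0 bT].
have [->|b_neq0] := eqVneq b 0; first by rewrite subr0.
have {b_neq0}b0 : 0 < b by rewrite lt_neqAle eq_sym b_neq0.
have solb : solution `[0, b] (feedback Tc y) y.
  move=> s /=; rewrite in_itv/= => /andP[s0 sb]; apply: sol.
  by rewrite /= in_itv/= s0 (le_lt_trans sb).
have yc := solution_within_continuous (ltW b0) solb.
have TcN0 (s : R) : s \in `[0, b] -> Tc - s != 0.
  rewrite in_itv/= => /andP[_ sb]; rewrite subr_eq0 gt_eqF//.
  exact: le_lt_trans bT.
(* Bootstrap: y continuous, so the feedback is continuous, so its primitive y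
   is differentiable. *)
have dy (s : R) : s \in `]0, b[ -> is_derive s 1 y (feedback Tc y s).
  move=> s0b; have := s0b; rewrite in_itv/= => /andP[s0 sb].
  have ys : {for s, continuous y} by exact: within_continuous_continuous s0b.
  have fs : {for s, continuous (feedback Tc y)}.
    apply: cvgM; last exact: cvgN.
    apply: cvgM; first exact: cvg_cst.
    apply: cvgV; first by apply: TcN0; exact: subset_itv_oo_cc.
    by apply: cvgB; [exact: cvg_cst|exact: cvg_id].
  have [|ifb _] := solb b; first by rewrite /= in_itv/= ltW//= lexx.
  have [dF F'] := continuous_FTC1_closed sb ifb s0 fs.
  (* The integral equation holds on [0, b] only, hence just near s. *)
  apply: (@near_eq_is_derive _ _ _ (fun r => y 0 +
      parameterized_integral lebesgue_measure 0 r (feedback Tc y))).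
    near=> r; rewrite (solb r _).2//=; apply: subset_itv_oo_cc.
    by near: r; exact: near_in_itvoo.
  rewrite -[X in is_derive _ _ _ X]add0r; apply: is_deriveD.
  by apply: DeriveDef => //; rewrite -derive1E.
pose q s := y s / (Tc - s).
have dV (s : R) : s \in `[0, b] ->
    is_derive s 1 (fun r : R => (Tc - r)^-1) ((Tc - s) ^- 2).
  move=> /TcN0 Ts.
  have dT : is_derive s 1 (fun r : R => Tc - r) (0 - 1) by exact: is_deriveB.
  have dV := @is_deriveV R (fun r : R => Tc - r) s _ 1 Ts dT.
  apply: is_derive_eq dV _.
  by rewrite sub0r scalerN scaleNr opprK scaler1.
have dq (s : R) : s \in `]0, b[ -> is_derive s 1 q 0.
  move=> s0b; have sb := subset_itv_oo_cc s0b.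
  have Ts := TcN0 s sb.
  apply: is_derive_eq; first exact: is_deriveM (dy s s0b) (dV s sb).
  by rewrite /feedback /kappa /v /GRing.scale/=; field.
have qc : {within `[0, b], continuous q}.
  have Vc : {within `[0, b], continuous (fun r : R => (Tc - r)^-1)}.
    by apply: derivable_within_continuous => s /dV[].
  by move=> s; apply: cvgM; [exact: yc|exact: Vc].
have [s _] := MVT b0 dq qc; rewrite mul0r => /eqP.
by rewrite subr_eq0 /q subr0 => /eqP.
Unshelve. all: by end_near. Qed.

Lemma solution_affine (R : realType) (T c x0 : R) (u : R -> R) :
  {in `[0, T[, u =1 cst c} -> solution `[0, T] u (fun t => x0 + c * t).
Proof.
move=> uc t /=; rewrite in_itv/= => /andP[t0 tT].
have uct : {in `[0, t[, u =1 cst c}.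
  move=> s; rewrite in_itv/= => /andP[s0 st].
  by apply: uc; rewrite in_itv/= s0 (lt_le_trans st).
split; first exact: integrable_eq_cst_co uct.
by rewrite /Rintegral (integral_eq_cst_co t0 uct)/= mulr0 addr0.
Qed.

Theorem proposition1 (R : realType) (Tc x0 : R) (hTc : 0 < Tc) :
  exists x : R -> R,
    [/\ closed_loop_trajectory Tc x0 x,
        (forall y : R -> R, closed_loop_trajectory Tc x0 y ->
           forall t, 0 <= t < Tc -> y t = x t)
      & minimizes_energy Tc x0 (feedback Tc x) x].
Proof.
have Tc_neq0 : Tc != 0 by rewrite gt_eqF.
pose c := - (x0 / Tc); pose x t := x0 + c * t.
have uc : {in `[0, Tc[, feedback Tc x =1 cst c}.
  move=> t; rewrite in_itv/= => /andP[_ tT].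
  have Tt_neq0 : Tc - t != 0 by rewrite subr_eq0 gt_eqF.
  by rewrite /feedback /kappa /v /x /c /=; field; rewrite Tc_neq0.
have sol : solution `[0, Tc] (feedback Tc x) x := solution_affine x0 uc.
have x_0 : x 0 = x0 by rewrite /x mulr0 addr0.
have x_Tc : x Tc = 0 by rewrite /x /c; field.
exists x; split.
- split=> // t /=; rewrite in_itv/= => /andP[t0 tT].
  by apply: sol; rewrite /= in_itv/= t0 ltW.
- move=> y yP t tT; have := closed_loop_quotient_cst yP tT.
  have Tt_neq0 : Tc - t != 0 by rewrite subr_eq0 gt_eqF//; case/andP: tT.
  move=> /(canRL (divfK Tt_neq0)) ->.
  by case: yP => _ ->; rewrite /x /c; field.
- split=> // w y [wy y_0 y_Tc].
  have [|iw] := wy Tc; first by rewrite /= in_itv/= lexx ltW.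
  rewrite y_0 y_Tc => /esym/eqP; rewrite addrC addr_eq0 => /eqP int_w.
  apply: le_trans (energy_ge c (ltW hTc) iw).
  have u2c : {in `[0, Tc[, (fun s => feedback Tc x s ^+ 2) =1 cst (c ^+ 2)}.
    by move=> s sT; rewrite /= uc.
  (* The lower bound for c is attained: 2 c (- x0) - c^2 Tc = c^2 Tc. *)
  rewrite /energy (integral_eq_cst_co (ltW hTc) u2c) int_w lee_fin.
  by rewrite le_eqVlt; apply/predU1P; left; rewrite /c; field.
Qed.
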